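(* Let $p$ be an odd prime, $m\ge3$ odd, $k\ge1$ even with $\gcd(m,k)=1$, and $\lambda$ a fixed nonsquare in $\mathbb{F}_p$. As $(a,b,c)$ runs through $\mathbb{F}_{p^m}^3$, the values of $S(a,b,c)$ and their frequencies are: - $2(p-1)p^m$: $1$; - $(p-1)p^m$: $2(p^m-1)$; - $(p-1)p^{\frac{m+1}{2}}$: $(p^m-1)(p^m-p^{m-1})(p^{m-1}+p^{\frac{m-1}{2}})$; - $-(p-1)p^{\frac{m+1}{2}}$: $(p^m-1)(p^m-p^{m-1})(p^{m-1}-p^{\frac{m-1}{2}})$; - $2(p-1)p^{\frac{m+1}{2}}$: $\frac14(p^m-1)(p^{m-1}+p^{\frac{m-1}{2}})^2$; - $-2(p-1)p^{\frac{m+1}{2}}$: $\frac14(p^m-1)(p^{m-1}-p^{\frac{m-1}{2}})^2$; - $0$: $(p^m-1)\big(p^{2m}+\frac32p^{2(m-1)}-2p^{2m-1}+p^m-\frac12p^{m-1}-1\big)$.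
   Context: $\mathrm{Tr}$ is the trace from $\mathbb{F}_{p^m}$ to $\mathbb{F}_p$ and $\zeta_p=e^{2\pi i/p}$. $S(a,b,c)=\sum_{y\in\mathbb{F}_p^*}\sum_{x\in\mathbb{F}_{p^m}}\big(\zeta_p^{y\,\mathrm{Tr}((a+b)x^2+cx^{p^k+1})}+\zeta_p^{y\,\mathrm{Tr}((a-b)\lambda x^2+c\lambda x^{p^k+1})}\big)$. *)

(* Defs.v *)
From HB Require Import structures.
From mathcomp Require Import all_boot all_order all_algebra all_field.
Set Implicit Arguments. Unset Strict Implicit. Unset Printing Implicit Defensive.
Import Order.TTheory GRing.Theory Num.Theory.
Local Open Scope ring_scope.

(* zeta_p = e^{2 pi i / p}: p.-root (-1) is the root of -1 of minimal
   argument, i.e. e^{i pi / p}; its square is e^{2 pi i / p}. *)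
Definition zeta (p : nat) : algC := (p.-root (-1)) ^+ 2.

(* absolute trace F_{p^m} -> F_p (value lies in the prime subfield of F) *)
Definition trF (F : finFieldType) (p m : nat) (x : F) : F :=
  \sum_(i < m) x ^+ (p ^ i).

(* the representative n in {0,...,p-1} of an element u = n%:R of the prime field *)
Definition fp_nat (F : finFieldType) (p : nat) (u : F) : nat :=
  find (fun n : nat => n%:R == u) (iota 0 p).

Definition psi (F : finFieldType) (p : nat) (u : F) : algC :=
  zeta p ^+ fp_nat p u.

(* S(a,b,c); y ranges over F_p^* = {1,...,p-1}, lam is lambda *)
Definition S (F : finFieldType) (p m k : nat) (lam a b c : F) : algC :=
  \sum_(y < p | (0 < y)%N) \sum_(x : F)
    (psi p (y%:R * trF p m ((a + b) * x ^+ 2 + c * x ^+ (p ^ k + 1)))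
   + psi p (y%:R * trF p m ((a - b) * lam * x ^+ 2 + c * lam * x ^+ (p ^ k + 1)))).

Definition freq (F : finFieldType) (p m k : nat) (lam : F) (v : algC) : nat :=
  #|[set t : F * F * F | S p m k lam t.1.1 t.1.2 t.2 == v]|.

(* Main.v *)
(* Since lambda lies in F_p, the second inner sum of S becomes the first one
   after the substitution y := lambda y, so S(a,b,c) = T(a+b,c) + T(a-b,c) where
   T(u,c) sums over y in F_p^* the exponential sum of y Q for the quadratic form
   Q(x) = Tr(u x^2 + c x^(p^k+1)) over F_p.  Splitting off orthogonal lines shows
   that the sum of lambda Q is (-1)^r times the sum of Q, r being the rank of Q;
   hence T vanishes for odd r and is +-(p-1) p^(m-r/2) for even r.  The radical of
   Q is killed by a second-order semilinear equation in the Frobenius x -> x^(p^k),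
   whose fixed field is F_p, so it has at most p^2 elements and r >= m-2.  For
   fixed c <> 0, T(u,c) therefore takes three values; its first two moments over u
   do not depend on c (as m is odd, the square roots in F_{p^m} of an element of
   F_p that has one lie in F_p), and they determine the distribution. *)
Require Import Defs.
From HB Require Import structures.
From mathcomp Require Import all_boot all_order all_algebra all_field.
From mathcomp Require Import ring zify.
Import Order.TTheory GRing.Theory Num.Theory.
Local Open Scope ring_scope.
Set Implicit Arguments. Unset Strict Implicit. Unset Printing Implicit Defensive.


(** * The additive character of F_p and its quadratic Gauss sums *)

Section FpCharacter.

Variable p : nat.
Hypotheses (p_pr : prime p) (p_odd : odd p).

Definition chr (a : 'F_p) : algC := zeta p ^+ a.

(** The order divides p because [p.-root (-1)] has p-th power -1. Order 1 would make this root 1 or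
    -1: the former has p-th power 1, and [rootC_lt0] excludes a negative principal root. *)
Lemma zeta_prim : p.-primitive_root (zeta p).
Proof.
have p_gt1 := prime_gt1 p_pr; have p_gt0 := ltnW p_gt1.
have rp : p.-root (-1 : algC) ^+ p = -1 by exact: rootCK.
have zp : zeta p ^+ p = 1 by rewrite /zeta exprAC rp sqrrN expr1n.
have [d pd] := prim_order_exists p_gt0 zp.
have [_ dvd_p] := primeP p_pr.
case/dvd_p/orP=> /eqP d_p; last by move: pd; rewrite d_p.
have /eqP := prim_expr_order pd; rewrite d_p expr1 /zeta sqrf_eq1.
case/orP=> /eqP r1; last by have := @rootC_lt0 algC p (-1) p_gt1; rewrite r1 ltrN10.
by move: rp; rewrite r1 expr1n => /eqP; rewrite -subr_eq0 opprK (pnatr_eq0 _ 2).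
Qed.

Lemma chrD a b : chr (a + b) = chr a * chr b.
Proof.
rewrite /chr -exprD -[in RHS](prim_expr_mod zeta_prim) /=.
by rewrite {3}(Fp_cast p_pr).
Qed.

Lemma chr0 : chr 0 = 1. Proof. by []. Qed.

Lemma chr_eq1 a : (chr a == 1) = (a == 0).
Proof.
rewrite /chr -(prim_order_dvd zeta_prim) (dvdn_pcharf (pchar_Fp p_pr)).
by rewrite natr_Zp.
Qed.

Lemma two_neq0_Fp : (2%:R : 'F_p) != 0.
Proof.
rewrite -(dvdn_pcharf (pchar_Fp p_pr)); apply: contraL p_odd => p2.
by have := dvdn_prime2 p_pr (isT : prime 2); rewrite p2 => /esym/eqP->.
Qed.

(** Translating by [x0] multiplies the sum by [chr (f x0)], which differs from 1. *)
Lemma sum_chr_hom (I : finZmodType) (f : I -> 'F_p) :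
  {morph f : x y / x + y} -> (exists x, f x != 0) -> \sum_x chr (f x) = 0.
Proof.
move=> fD [x0 fx0]; apply/eqP.
have /eqP: \sum_x chr (f x) = chr (f x0) * \sum_x chr (f x).
  rewrite mulr_sumr (reindex_inj (addrI x0)).
  by apply: eq_bigr => x _; rewrite fD chrD.
rewrite -subr_eq0 -[X in X - _]mul1r -mulrBl mulf_eq0 subr_eq0 eq_sym chr_eq1.
by rewrite (negPf fx0).
Qed.

Lemma sum_chr_mul (a : 'F_p) : a != 0 -> \sum_x chr (a * x) = 0.
Proof.
move=> a0; apply: sum_chr_hom => [x y|]; first exact: mulrDr.
by exists 1; rewrite mulr1.
Qed.

Lemma sum_Fp_neq0_const (w : algC) :
  \sum_(y : 'F_p | y != 0) w = (p%:R - 1) * w.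
Proof.
rewrite sumr_const mulrBl mul1r mulr_natl.
have -> : #|[pred y : 'F_p | y != 0]| = p.-1.
  by rewrite -[in RHS](card_Fp p_pr) (cardC1 (0 : 'F_p)).
by rewrite -[X in _ *+ X - _](prednK (prime_gt0 p_pr)) mulrS addrC addrK.
Qed.

Definition gauss (a : 'F_p) : algC := \sum_x chr (a * x ^+ 2).

Lemma gauss0 : gauss 0 = p%:R.
Proof.
rewrite /gauss (eq_bigr (fun=> 1)) => [|x _]; last by rewrite mul0r chr0.
by rewrite sumr_const card_Fp.
Qed.

(** With x = z + s the exponent a(x^2 - z^2) becomes a s^2 + 2 a s z, linear in z, so summing over z
    leaves only s = 0. *)
Lemma gauss_mulN a : a != 0 -> gauss a * gauss (- a) = p%:R.
Proof.
move=> a0; rewrite /gauss mulr_sumr.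
pose E z s := chr (a * s ^+ 2) * chr (a * (2%:R * s) * z).
transitivity (\sum_z \sum_s E z s).
  apply: eq_bigr => z _; rewrite mulr_suml (reindex_inj (addrI z)) /=.
  by apply: eq_bigr => s _; rewrite /E -!chrD; congr chr; ring.
rewrite exchange_big (bigD1 0) //= [X in _ + X]big1 => [|s s0].
  rewrite addr0 (eq_bigr (fun=> 1)) => [|z _]; first by rewrite sumr_const card_Fp.
  by rewrite /E !(expr0n, mulr0, mul0r) chr0 mulr1.
by rewrite -mulr_sumr sum_chr_mul ?mulr0 // !mulf_neq0 ?two_neq0_Fp.
Qed.

Section NonSquare.

Variable lam : 'F_p.
Hypothesis lam_nsq : forall x, x ^+ 2 != lam.

Lemma nsq_neq0 : lam != 0.
Proof. by have := lam_nsq 0; rewrite expr0n eq_sym. Qed.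

(** The total never exceeds 2, since for y nonzero solutions of both kinds would make [lam] a
    square. Summed over y it is 2p, so every bound is attained. *)
Lemma card_sqrt_nsq (y : 'F_p) :
  (#|[pred x : 'F_p | x ^+ 2 == y]%R| + #|[pred x : 'F_p | lam * x ^+ 2 == y]%R| = 2)%N.
Proof.
have lam0 := nsq_neq0.
have two0 := two_neq0_Fp.
have sqrt_le2 (mu z : 'F_p) : mu != 0 -> (#|[pred x : 'F_p | mu * x ^+ 2 == z]%R| <= 2)%N.
  move=> mu0; case: (pickP [pred x : 'F_p | mu * x ^+ 2 == z]) => [x xz|n0]; last first.
    by rewrite (eq_card0 n0).
  apply: leq_trans (_ : #|pred2 x (- x)| <= 2)%N; last by rewrite card2; case: eqP.
  apply/subset_leq_card/subsetP=> w; rewrite !inE -eqf_sqr /= -(eqP xz).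
  by move/eqP/(mulfI mu0)->.
pose N y := (#|[pred x : 'F_p | x ^+ 2 == y]%R| + #|[pred x : 'F_p | lam * x ^+ 2 == y]%R|)%N.
have N_le z : (N z <= 2)%N.
  case: (eqVneq z 0) => [->|z0].
    rewrite /N !(@eq_card _ _ (pred1 (0 : 'F_p))) ?card1 // => x; rewrite !inE.
      by rewrite mulf_eq0 (negPf lam0) sqrf_eq0.
    by rewrite sqrf_eq0.
  case: (pickP [pred x : 'F_p | lam * x ^+ 2 == z]) => [x /= /eqP xz|n0]; last first.
    rewrite /N (eq_card0 n0) addn0.
    rewrite (@eq_card _ _ [pred x : 'F_p | 1 * x ^+ 2 == z]) ?sqrt_le2 ?oner_eq0 // => x.
    by rewrite !inE mul1r.
  rewrite /N [X in (X + _)%N]eq_card0 ?add0n ?sqrt_le2 // => w; rewrite !inE.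
  apply/negP=> /eqP wz; have x0 : x != 0.
    by apply: contraNneq z0 => x0; rewrite -xz x0 expr0n mulr0.
  by have /eqP[] := lam_nsq (w / x); rewrite expr_div_n wz -xz mulfK // sqrf_eq0.
have sumN : (\sum_z N z = \sum_(z : 'F_p) 2)%N.
  rewrite big_split /= sum_nat_const card_Fp // muln2 -addnn.
  have card_fib (f : 'F_p -> 'F_p) : (\sum_z #|[pred x | f x == z]%R| = p)%N.
    rewrite -[RHS](card_Fp p_pr) -sum1_card [RHS](partition_big f predT) //=.
    by apply: eq_bigr => z _; rewrite -sum1_card.
  by rewrite (card_fib (fun x => x ^+ 2)) (card_fib (fun x => lam * x ^+ 2)).
apply/eqP; rewrite -/(N y).
(* Equality of the two sums forces equality term by term. *)
have := @leqif_sum _ predT (fun z => N z == 2%N) N (fun=> 2%N) (fun z _ => leqif_eq (N_le z)).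
by case=> _; rewrite sumN eqxx => /esym/forallP/(_ y).
Qed.

Lemma sq_or_nsq (y : 'F_p) : exists x, y = x ^+ 2 \/ y = lam * x ^+ 2.
Proof.
case: (pickP [pred x : 'F_p | x ^+ 2 == y]) => [x /eqP <-|n1]; first by exists x; left.
case: (pickP [pred x : 'F_p | lam * x ^+ 2 == y]) => [x /eqP <-|n2]; first by exists x; right.
by have := card_sqrt_nsq y; rewrite (eq_card0 n1) (eq_card0 n2).
Qed.

(** Squares and [lam] times squares together cover each y exactly twice, so the two Gauss sums add
    up to twice a full character sum, which vanishes. *)
Lemma gauss_nsq a : a != 0 -> gauss (lam * a) = - gauss a.
Proof.
move=> a0; apply/eqP; rewrite -addr_eq0 addrC; apply/eqP.
have fib (f : 'F_p -> 'F_p) :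
    \sum_x chr (a * f x) = \sum_y chr (a * y) *+ #|[pred x | f x == y]%R|.
  rewrite (partition_big f predT) //=; apply: eq_bigr => y _.
  by rewrite -sumr_const; apply: eq_bigr => x /eqP->.
have -> : gauss (lam * a) = \sum_x chr (a * (lam * x ^+ 2)).
  by apply: eq_bigr => x _; rewrite (mulrC lam) -mulrA.
rewrite /gauss (fib (fun x => x ^+ 2)) (fib (fun x => lam * x ^+ 2)) -big_split /=.
under eq_bigr => y _ do rewrite -mulrnDr card_sqrt_nsq.
by rewrite sumrMnl sum_chr_mul ?mul0rn.
Qed.

End NonSquare.

End FpCharacter.


(** * The prime field inside F, powers of Frobenius, and the trace *)

Section PrimeSubfield.

Variables (F : finFieldType) (p : nat).
Hypothesis charF : p \in [pchar F].
Let p_pr : prime p := pcharf_prime charF.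

Definition fpin (a : 'F_p) : F := (nat_of_ord a)%:R.

Lemma fpin_nat n : fpin n%:R = n%:R.
Proof. by rewrite /fpin val_Fp_nat // (GRing.natr_mod_pchar charF). Qed.

Lemma fpinD a b : fpin (a + b) = fpin a + fpin b.
Proof. by rewrite -[a]natr_Zp -[b]natr_Zp -natrD !fpin_nat natrD. Qed.

Lemma fpinM a b : fpin (a * b) = fpin a * fpin b.
Proof. by rewrite -[a]natr_Zp -[b]natr_Zp -natrM !fpin_nat natrM. Qed.

Lemma fpinN a : fpin (- a) = - fpin a.
Proof. by apply/eqP; rewrite -addr_eq0 -fpinD addNr. Qed.

Lemma fpin_eq0 a : (fpin a == 0) = (a == 0).
Proof.
by rewrite /fpin -(dvdn_pcharf charF) (dvdn_pcharf (pchar_Fp p_pr)) natr_Zp.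
Qed.

Lemma fpin_inj : injective fpin.
Proof.
move=> a b /eqP; rewrite -subr_eq0 -fpinN -fpinD fpin_eq0 subr_eq0.
by move/eqP.
Qed.

(** Injectivity of [fpin] makes the search in [fp_nat] stop exactly at the representative of a; from
    here on [chr] replaces [psi]. *)
Lemma psi_fpin a : psi p (fpin a) = chr a.
Proof.
rewrite /psi /chr; congr (_ ^+ _); rewrite /fp_nat.
have ap : (a < p)%N by rewrite -{2}(Fp_cast p_pr) ltn_ord.
apply/eqP; rewrite eqn_leq; apply/andP; split.
  rewrite leqNgt; apply/negP=> /(before_find 0).
  by rewrite nth_iota // add0n /fpin eqxx.
set n := find _ _; have hasn : has (fun n : nat => n%:R == fpin a) (iota 0 p).
  by apply/hasP; exists (nat_of_ord a); rewrite ?mem_iota.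
have np : (n < p)%N by move: hasn; rewrite has_find size_iota.
have := nth_find 0 hasn; rewrite -/n nth_iota // add0n -fpin_nat => /eqP/fpin_inj <-.
by rewrite val_Fp_nat // leq_mod.
Qed.

Lemma sum_nonzero_Fp (f : nat -> algC) :
  \sum_(y < p | (0 < y)%N) f y = \sum_(y : 'F_p | y != 0) f y.
Proof.
rewrite -(big_mkord (fun i => (0 < i)%N) f) -{1}(Fp_cast p_pr) big_mkord.
by apply: eq_bigl => y; rewrite lt0n.
Qed.

Definition expp (j : nat) (x : F) : F := x ^+ (p ^ j).

Lemma exppD j x y : expp j (x + y) = expp j x + expp j y.
Proof. by rewrite /expp exprDn_pchar // pnatX pnatE ?charF. Qed.

Lemma exppM j x y : expp j (x * y) = expp j x * expp j y.
Proof. exact: exprMn. Qed.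

Lemma expp_add i j x : expp i (expp j x) = expp (i + j) x.
Proof. by rewrite /expp -exprM -expnD addnC. Qed.

Lemma expp0 j : expp j 0 = 0.
Proof. by rewrite /expp expr0n expn_eq0 -leqn0 leqNgt prime_gt0. Qed.

Lemma exppN j x : expp j (- x) = - expp j x.
Proof. by apply/eqP; rewrite -addr_eq0 -exppD addNr expp0. Qed.

Lemma expp_eq0 j x : (expp j x == 0) = (x == 0).
Proof. by rewrite /expp expf_eq0 expn_gt0 prime_gt0. Qed.

Lemma expp_iter j n x : expp j x = x -> expp (n * j) x = x.
Proof. by move=> jx; elim: n => [|n IH] //; rewrite mulSn -expp_add IH. Qed.

Lemma expp_fpin j a : expp j (fpin a) = fpin a.
Proof.
suff f1 : expp 1 (fpin a) = fpin a by rewrite -(muln1 j) expp_iter.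
rewrite /expp expn1 -(pFrobenius_autE charF) /fpin rmorph_nat //.
Qed.

(** The p elements of the prime field are already roots of X^p - X, so one further fixed point would
    exceed its degree. *)
Lemma fpin_fixed x : expp 1 x = x -> exists a, x = fpin a.
Proof.
move=> xx; have [/existsP[a /eqP->]|] := boolP [exists a, x == fpin a]; first by exists a.
rewrite negb_exists => /forallP nx.
pose P : {poly F} := 'X^p - 'X.
have sP : size P = p.+1.
  by rewrite size_polyDl ?size_polyXn // size_polyN size_polyX ltnS prime_gt1.
have P0 : P != 0 by rewrite -size_poly_eq0 sP.
have := @max_poly_roots _ P (x :: map fpin (enum 'F_p)) P0.
rewrite /= size_map -cardE card_Fp // sP ltnn (map_inj_uniq fpin_inj) enum_uniq andbT.
have rootE y : root P y = (expp 1 y == y) by rewrite /root !hornerE subr_eq0 /expp expn1.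
rewrite rootE xx eqxx /= => H; suff: false by [].
apply: H.
  by apply/allP=> _ /mapP[a _ ->]; rewrite rootE expp_fpin.
by apply/mapP=> -[a _ xa]; have := nx a; rewrite xa eqxx.
Qed.

Section Trace.

Variable m : nat.
Hypothesis cardF : #|F| = (p ^ m)%N.

Lemma expp_card x : expp m x = x.
Proof. by rewrite /expp -cardF expf_card. Qed.

Lemma degree_gt0 : (0 < m)%N.
Proof. by case: m cardF (card_finNzRing_gt1 F) => // ->. Qed.

Lemma trFD : {morph @trF F p m : x y / x + y}.
Proof.
by move=> x y; rewrite /trF -big_split; apply: eq_bigr => i _; exact: exppD.
Qed.

Lemma trF_fpinM a x : trF p m (fpin a * x) = fpin a * trF p m x.
Proof.
rewrite /trF mulr_sumr; apply: eq_bigr => i _.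
by rewrite -[LHS]/(expp i _) exppM expp_fpin.
Qed.

(** Frobenius permutes the m terms of the trace cyclically; the last one wraps around by x^(p^m) =
    x. *)
Lemma trF_expp j x : trF p m (expp j x) = trF p m x.
Proof.
elim: j => [|j <-]; first by rewrite /expp expr1.
rewrite -addn1 addnC -expp_add; set y := expp j x; rewrite /trF.
case: m degree_gt0 expp_card => // n _ cardn.
rewrite big_ord_recr big_ord_recl /= addrC; congr (_ + _).
  rewrite -[LHS]/(expp n _) expp_add addn1 cardn. by rewrite expr1.
by apply: eq_bigr => i _; rewrite -[LHS]/(expp i _) expp_add addn1.
Qed.

Lemma expp_trF x : expp 1 (trF p m x) = trF p m x.
Proof.
rewrite -[RHS](trF_expp 1) /trF (big_morph _ (exppD 1) (expp0 1)).
by apply: eq_bigr => i _; rewrite -[X in expp 1 X]/(expp i x) -[RHS]/(expp i _) !expp_add addnC.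
Qed.

(** The trace with values in ['F_p] itself. The default 0 is never reached, because [trF] is fixed
    by Frobenius ([trE]). *)
Definition tr (x : F) : 'F_p := odflt 0 [pick a | trF p m x == fpin a].

Lemma trE x : fpin (tr x) = trF p m x.
Proof.
rewrite /tr; case: pickP => [a /eqP ->|n] //=.
by have [a xa] := fpin_fixed (expp_trF x); have := n a; rewrite xa eqxx.
Qed.

Lemma trD x y : tr (x + y) = tr x + tr y.
Proof. by apply: fpin_inj; rewrite fpinD !trE trFD. Qed.

Lemma tr0 : tr 0 = 0.
Proof. by apply: (addrI (tr 0)); rewrite -trD !addr0. Qed.

Lemma tr_fpinM a x : tr (fpin a * x) = a * tr x.
Proof. by apply: fpin_inj; rewrite fpinM !trE trF_fpinM. Qed.

Lemma tr_expp j x : tr (expp j x) = tr x.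
Proof. by apply: fpin_inj; rewrite !trE trF_expp. Qed.

Lemma psi_tr (y : 'F_p) x : psi p ((nat_of_ord y)%:R * trF p m x) = chr (y * tr x).
Proof. by rewrite -[_%:R]/(fpin y) -trE -fpinM psi_fpin. Qed.

(** As a polynomial the trace has degree p^(m-1), too small to vanish on all p^m elements. *)
Lemma tr_nontrivial : exists x, tr x != 0.
Proof.
apply/existsP; apply: contraT; rewrite negb_exists => /forallP ntr.
pose P : {poly F} := \sum_(i < m) 'X^(p ^ i).
have sP : size P = (p ^ m.-1).+1.
  rewrite /P; case: m degree_gt0 => // n _; rewrite big_ord_recr /=.
  rewrite addrC size_polyDl size_polyXn // ltnS.
  apply: leq_trans (size_sum _ _ _) _; apply/bigmax_leqP => i _.
  by rewrite size_polyXn ltn_exp2l ?prime_gt1.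
have P0 : P != 0 by rewrite -size_poly_eq0 sP.
have : all (root P) (enum F).
  apply/allP=> x _; rewrite /root horner_sum.
  under eq_bigr => i _ do rewrite hornerXn.
  by have /negPn/eqP t0 := ntr x; rewrite -[X in X == 0]/(trF p m x) -trE t0.
move/(max_poly_roots P0)/(_ (enum_uniq _)).
rewrite -cardE cardF sP ltnS leqNgt ltn_exp2l ?prime_gt1 //.
by rewrite prednK ?degree_gt0 // leqnn.
Qed.

Lemma sum_chr_tr w : \sum_u chr (tr (u * w)) = if w == 0 then (p ^ m)%:R else 0.
Proof.
case: eqP => [->|/eqP w0].
  rewrite (eq_bigr (fun=> 1)) => [|u _]; last by rewrite mulr0 tr0 chr0.
  by rewrite sumr_const cardF.
apply: (sum_chr_hom p_pr) => [x y|]; first by rewrite mulrDl trD.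
by have [x x0] := tr_nontrivial; exists (x / w); rewrite divfK.
Qed.

Lemma tr_nondeg w : (forall u, tr (u * w) = 0) -> w = 0.
Proof.
move=> tr_w; apply/eqP; apply: contraT => w0.
by have [x] := tr_nontrivial; rewrite -(divfK w0 x) tr_w eqxx.
Qed.

(** By Bezout, 1 + v k = u m. Both the k-th and the m-th power of Frobenius fix x, hence so does
    Frobenius. *)
Lemma expp_fixed k x : coprime m k -> expp k x = x -> exists a, x = fpin a.
Proof.
move=> mk kx; apply: fpin_fixed.
have [[u v] /= uv] := coprimeP k degree_gt0 mk.
have e : (1 + v * k = u * m)%N by lia.
by rewrite -{1}(expp_iter v kx) expp_add e expp_iter // expp_card.
Qed.

End Trace.

End PrimeSubfield.


(** * Exponential sums of an abstract quadratic form [Q] over F_p with polar form [B] *)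

Section QuadraticForm.

Variables (F : finFieldType) (p : nat).
Hypotheses (charF : p \in [pchar F]) (p_odd : odd p).
Let p_pr : prime p := pcharf_prime charF.

Variable lam : 'F_p.
Hypothesis lam_nsq : forall x, x ^+ 2 != lam.

Variables (Q : F -> 'F_p) (B : F -> F -> 'F_p).
Hypotheses (QD : forall x y, Q (x + y) = Q x + Q y + B x y)
  (QZ : forall a x, Q (fpin F a * x) = a ^+ 2 * Q x)
  (BD : forall x y z, B x (y + z) = B x y + B x z)
  (BZ : forall a x y, B x (fpin F a * y) = a * B x y).

Lemma polarC x y : B x y = B y x.
Proof.
apply: (addrI (Q x + Q y)); rewrite -QD [x + y]addrC QD.
by rewrite [Q y + Q x]addrC.
Qed.

Lemma polar_diag x : B x x = 2%:R * Q x.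
Proof.
apply: (addrI (Q x + Q x)); rewrite -QD.
have -> : x + x = fpin F (2%:R : 'F_p) * x by rewrite (fpin_nat charF) mulr2n mulrDl mul1r.
by rewrite QZ; ring.
Qed.

(** For nonempty V this says that V is an F_p-subspace; the equality of memberships is the form
    needed to reindex a sum by a translation. *)
Definition scale_closed (V : {set F}) :=
  forall (a : 'F_p) v w, v \in V -> (fpin F a * v + w \in V) = (w \in V).

Definition qsum (V : {set F}) (y : 'F_p) : algC := \sum_(x in V) chr (y * Q x).

Lemma qsum0 V : qsum V 0 = #|V|%:R.
Proof.
rewrite /qsum (eq_bigr (fun=> 1)) => [|x _]; first by rewrite sumr_const.
by rewrite mul0r chr0.
Qed.

Definition orth (V : {set F}) v := [set w in V | B v w == 0].

Lemma orth_scale_closed V v : scale_closed V -> scale_closed (orth V v).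
Proof.
move=> Vc a w z; rewrite !inE => /andP[wV /eqP vw0].
by rewrite Vc // BD BZ vw0 mulr0 add0r.
Qed.

(** As B v v = 2 Q v is nonzero, V is the direct sum of the line of v and its orthogonal, on which
    Q(a v + w) = a^2 Q v + Q w. *)
Lemma qsum_orth V v y : scale_closed V -> v \in V -> Q v != 0 ->
  qsum V y = gauss (y * Q v) * qsum (orth V v) y.
Proof.
move=> Vc vV Qv0; have Bv0 : B v v != 0.
  by rewrite polar_diag mulf_neq0 ?two_neq0_Fp.
(* [B v x / B v v] is the coordinate of x along v. *)
rewrite /qsum (partition_big (fun x => B v x / B v v) predT) //=.
rewrite /gauss mulr_suml; apply: eq_bigr => a _.
rewrite mulr_sumr (reindex_inj (addrI (fpin F a * v))) /=.
apply: eq_big => [w|w /andP[_ /eqP wa]].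
  rewrite inE Vc // BD BZ mulrDl mulfK //; congr (_ && _).
  by rewrite -subr_eq0 addrC addKr mulf_eq0 invr_eq0 (negPf Bv0) orbF.
have vw0 : B v w = 0.
  apply: (mulIf (invr_neq0 Bv0)); rewrite mul0r.
  by apply: (addrI a); rewrite addr0 -[RHS]wa BD BZ mulrDl mulfK.
rewrite -chrD // QD QZ [B _ w]polarC BZ [B w v]polarC vw0.
by congr chr; ring.
Qed.

(* N is the cardinality of the radical of the restriction of Q to V. *)
Lemma qsum_rank V : scale_closed V -> exists r N : nat,
  [/\ qsum V 0 = (p ^ r * N)%:R,
      forall y : 'F_p, y != 0 -> qsum V (lam * y) = (-1) ^+ r * qsum V y
    & forall y : 'F_p, y != 0 -> qsum V y * qsum V (- y) = (p ^ r * N ^ 2)%:R].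
Proof.
(* Induction on the size of V, removing one vector with Q v nonzero at a time; when Q vanishes on V,
   r = 0 and N = #|V|. *)
have [n leVn] := ubnP #|V|; elim: n V leVn => // n IH V ltVn Vc.
have [/exists_inP[v vV Qv0]|] := boolP [exists v in V, Q v != 0]; last first.
  rewrite negb_exists_in => /forall_inP Q0.
  have qV y : qsum V y = #|V|%:R.
    rewrite -qsum0; apply: eq_bigr => x xV.
    by rewrite (eqP (negPn (Q0 x xV))) !mulr0.
  exists 0%N, #|V|; split=> [|y _|y _]; rewrite !qV ?mul1n //.
    by rewrite expr0 mul1r.
  by rewrite expnS expn1 natrM.
have ltV' : (#|orth V v| < n)%N.
  apply: leq_trans (_ : #|V| <= n)%N; last by rewrite -ltnS.
  apply/proper_card/properP; split; first by apply/subsetP=> w; rewrite inE => /andP[].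
  by exists v; rewrite // inE vV polar_diag mulf_neq0 ?two_neq0_Fp.
have [r [N [q0 qlam qN]]] := IH _ ltV' (@orth_scale_closed V v Vc).
have qV y := qsum_orth y Vc vV Qv0.
(* The vector removed contributes one Gauss sum: p at y = 0, a change of sign under y := lam y, and
   p in the product for y and -y. *)
exists r.+1, N; split=> [|y y0|y y0]; rewrite !qV.
- by rewrite q0 mul0r gauss0 // -natrM mulnA expnS.
- by rewrite qlam // -mulrA (gauss_nsq p_pr) ?mulf_neq0 // exprS; ring.
by rewrite mulrACA qN // mulNr gauss_mulN ?mulf_neq0 // -natrM mulnA -expnS.
Qed.

Definition radical := [set x | [forall z, B x z == 0]].

(** After x = z + s the sum over z is that of the character of [B s], which vanishes for s outside
    the radical; on the radical Q s = 0, because B s s = 2 Q s. *)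
Lemma qsum_radical :
  qsum setT 1 * qsum setT (- 1) = #|F|%:R * #|radical|%:R.
Proof.
rewrite /qsum mulr_sumr.
transitivity (\sum_z \sum_s chr (Q s) * chr (B s z)).
  apply: eq_big => [z|z _]; first by rewrite inE.
  rewrite mulr_suml (reindex_inj (addrI z)) /=.
  apply: eq_big => [s|s _]; first by rewrite inE.
  rewrite -!chrD // QD [B z s]polarC; congr chr; ring.
rewrite exchange_big (bigID (mem radical)) /= [X in _ + X]big1 => [|s sr].
  rewrite addr0 mulr_natr -sumr_const; apply: eq_bigr => s.
  rewrite inE => /forallP sr.
  have Qs : Q s = 0.
    by apply: (mulfI (two_neq0_Fp p_pr p_odd)); rewrite mulr0 -polar_diag (eqP (sr s)).
  rewrite (eq_bigr (fun=> 1)) ?sumr_const // => z _.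
  by rewrite Qs (eqP (sr z)) chr0 mulr1.
rewrite -mulr_sumr (sum_chr_hom p_pr (BD s)) ?mulr0 //.
by move: sr; rewrite inE negb_forall => /existsP.
Qed.

Lemma qsum_sq s y : s != 0 -> qsum setT (s ^+ 2 * y) = qsum setT y.
Proof.
move=> s0; have s0' : fpin F s != 0 by rewrite (fpin_eq0 charF).
rewrite [RHS](reindex_inj (mulfI s0')).
apply: eq_big => [x|x _]; first by rewrite !inE.
by rewrite QZ mulrA [y * _]mulrC.
Qed.

(** Here r is the rank of Q and [w] the common value of the sums for all nonzero y when r is
    even. *)
Lemma qsum_total m : #|F| = (p ^ m)%N -> exists2 r : nat,
  (r <= m)%N /\ #|radical| = (p ^ (m - r))%N &
  if odd r then \sum_(y : 'F_p | y != 0) qsum setT y = 0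
  else exists2 w : algC, w ^+ 2 = (p ^ (m + (m - r)))%:R &
         \sum_(y : 'F_p | y != 0) qsum setT y = (p%:R - 1) * w.
Proof.
move=> cardF; have lam0 := nsq_neq0 lam_nsq.
have p_gt0 := prime_gt0 p_pr.
have [|r [N [q0 qlam qN]]] := @qsum_rank setT; first by move=> a v w _; rewrite !inE.
(* The value at y = 0 is the size of F, which makes N a power of p. *)
have pm : (p ^ m = p ^ r * N)%N.
  by apply/eqP; rewrite -(eqr_nat algC) -q0 qsum0 cardsT cardF.
have rm : (r <= m)%N.
  by rewrite -(dvdn_Pexp2l _ _ (prime_gt1 p_pr)) pm dvdn_mulr.
have NE : N = (p ^ (m - r))%N.
  by apply/eqP; rewrite -(eqn_pmul2l (_ : 0 < p ^ r)%N) ?expn_gt0 ?p_gt0 // -pm -expnD subnKC.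
(* The product for y = 1 and -1 is p^r N^2 = p^m N, and by [qsum_radical] also p^m times the size of
   the radical. *)
have radN : #|radical| = N.
  apply/eqP; rewrite -(eqn_pmul2l (_ : 0 < p ^ m)%N) ?expn_gt0 ?p_gt0 //.
  rewrite -(eqr_nat algC) natrM -cardF -qsum_radical qN ?oner_eq0 // eqr_nat.
  by rewrite cardF pm -mulnA.
exists r; first by rewrite radN NE.
case: ifP => r_odd.
  (* For odd r the substitution y := lam y turns the total into its opposite. *)
  set T := \sum_(y | _) _; suff : T = - T.
    by move/eqP; rewrite -addr_eq0 -mulr2n -mulr_natl mulf_eq0 pnatr_eq0 /= => /eqP.
  rewrite {1}/T (reindex_inj (mulfI lam0)) /= -sumrN.
  apply: eq_big => [y|y]; first by rewrite mulf_eq0 (negPf lam0).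
  rewrite mulf_eq0 (negPf lam0) => /= y0.
  by rewrite qlam // -signr_odd r_odd expr1 mulN1r.
(* For even r neither a square factor nor [lam] changes the sum, and every y is a square or [lam]
   times one. *)
have q1 y : y != 0 -> qsum setT y = qsum setT 1.
  have [s [->|->]] := sq_or_nsq p_pr p_odd lam_nsq y.
    by rewrite sqrf_eq0 => s0; rewrite -(qsum_sq 1 s0) mulr1.
  rewrite mulf_eq0 (negPf lam0) sqrf_eq0 => s0.
  by rewrite qlam ?sqrf_eq0 // -signr_odd r_odd mul1r -(qsum_sq 1 s0) mulr1.
exists (qsum setT 1).
  rewrite expr2 -{2}(q1 (- 1)) ?oppr_eq0 ?oner_eq0 // qN ?oner_eq0 //.
  by rewrite NE expnD pm NE -mulnA -expnD -mulnn -expnD.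
by rewrite (eq_bigr (fun=> qsum setT 1)) // sum_Fp_neq0_const.
Qed.

End QuadraticForm.


Lemma card_fibres_leq (T T' : finType) (f : T -> T') (A : {set T}) (C : {set T'}) N :
    (forall x, x \in A -> f x \in C) ->
    (forall x0, x0 \in A -> (#|[set x in A | f x == f x0]| <= N)%N) ->
  (#|A| <= #|C| * N)%N.
Proof.
move=> fC fN; rewrite -sum1_card (partition_big f (mem C)) //= -sum_nat_const.
apply: leq_sum => s _.
have [/exists_inP[x0 x0A /eqP<-]|] := boolP [exists x0 in A, f x0 == s].
  apply: leq_trans (fN x0 x0A); rewrite -sum1_card.
  by under [X in (_ <= X)%N]eq_bigl do rewrite inE.
rewrite negb_exists_in => /forall_inP nA; rewrite big_pred0 // => x.
by apply/negP=> /andP[/nA/negP].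
Qed.

(** * The trace forms Tr(u x^2 + c x^(p^k+1)): radical, values of T, and moments *)

Section TraceForm.

Variables (F : finFieldType) (p m k : nat).
Hypotheses (charF : p \in [pchar F]) (p_odd : odd p).
Hypotheses (cardF : #|F| = (p ^ m)%N) (mk : coprime m k).
Let p_pr : prime p := pcharf_prime charF.

Definition Qf (u c x : F) : 'F_p := tr p m (u * x ^+ 2 + c * x ^+ (p ^ k + 1)).

Local Notation sg := (expp p k).

Definition Bf (u c x z : F) : 'F_p :=
  tr p m (2%:R * u * x * z + c * (sg x * z + x * sg z)).

Lemma expr_pk1 (x : F) : x ^+ (p ^ k + 1) = sg x * x.
Proof. by rewrite exprD expr1. Qed.

Lemma QfD u c x y : Qf u c (x + y) = Qf u c x + Qf u c y + Bf u c x y.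
Proof.
rewrite /Qf /Bf -!(trD charF cardF) !expr_pk1 (exppD charF); congr tr; ring.
Qed.

Lemma QfZ u c a x : Qf u c (fpin F a * x) = a ^+ 2 * Qf u c x.
Proof.
rewrite /Qf !expr_pk1 exppM (expp_fpin charF) -(tr_fpinM charF cardF).
rewrite expr2 (fpinM charF); congr tr; ring.
Qed.

Lemma BfD u c x y z : Bf u c x (y + z) = Bf u c x y + Bf u c x z.
Proof. by rewrite /Bf -(trD charF cardF) (exppD charF); congr tr; ring. Qed.

Lemma BfZ u c a x y : Bf u c x (fpin F a * y) = a * Bf u c x y.
Proof.
rewrite /Bf -(tr_fpinM charF cardF) exppM (expp_fpin charF); congr tr; ring.
Qed.

Lemma card_fixed_leq : (#|[set x : F | sg x == x]| <= p)%N.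
Proof.
rewrite -[X in (_ <= X)%N](card_Fp p_pr) -cardsT.
apply: leq_trans (leq_imset_card (@fpin F p) _).
apply/subset_leq_card/subsetP=> x; rewrite inE => /eqP.
by case/(expp_fixed charF cardF mk) => a ->; rewrite imset_f.
Qed.

(** Quotients of solutions by a fixed nonzero solution are fixed by [sg], hence lie in F_p. *)
Lemma card_semilinear_leq (a b : F) : a != 0 ->
  (#|[set s | a * sg s == b * s]%R| <= p)%N.
Proof.
move=> a0; have p_gt0 := prime_gt0 p_pr.
have [s1 /andP[s10 /eqP s1E]|ns] := pickP [pred s | (s != 0) && (a * sg s == b * s)]; last first.
  apply: leq_trans p_gt0; rewrite -(cards1 (0 : F)).
  apply/subset_leq_card/subsetP=> s; rewrite !inE => sE.
  by have := ns s; rewrite /= sE andbT => /negbFE.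
rewrite -(card_imset _ (mulIf (invr_neq0 s10))).
apply: leq_trans card_fixed_leq; apply/subset_leq_card/subsetP=> _ /imsetP[s sE ->].
move: sE; rewrite !inE; set t := s / s1; have -> : s = t * s1 by rewrite divfK.
rewrite exppM => /eqP tE; apply/eqP.
have as0 : a * sg s1 != 0 by rewrite mulf_neq0 ?(expp_eq0 charF).
by apply: (mulIf as0); rewrite mulrCA tE s1E; ring.
Qed.

(** Invariance of the trace moves [sg] off z, turning B x z into the trace of z times an expression
    in x. That expression vanishes by nondegeneracy, and applying [sg] clears the inverse
    automorphism. *)
Lemma radical_semilinear u c x : x \in radical (Bf u c) ->
  sg c * sg (sg x) + sg (2%:R * u) * sg x + c * x = 0.
Proof.
rewrite inE => /forallP rx.
(* The inverse of [sg]: m iterations of [sg] raise to the power p^(mk), which is the identity on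
   F. *)
pose ti := expp p (m.-1 * k) : F -> F.
have sti y : sg (ti y) = y.
  rewrite /ti expp_add -mulSn prednK ?(degree_gt0 cardF) //.
  by rewrite mulnC expp_iter // (expp_card cardF).
have tis y : ti (sg y) = y.
  rewrite /ti expp_add addnC -mulSn prednK ?(degree_gt0 cardF) //.
  by rewrite mulnC expp_iter // (expp_card cardF).
have L0 : 2%:R * u * x + c * sg x + ti (c * x) = 0.
  apply: (tr_nondeg charF cardF) => z; rewrite -[RHS](eqP (rx z)) /Bf.
  have -> : z * (2%:R * u * x + c * sg x + ti (c * x)) =
     2%:R * u * x * z + c * sg x * z + ti (c * x) * z by ring.
  rewrite (trD charF cardF) -[z in X in _ + X]tis -exppM (tr_expp charF cardF).
  by rewrite -(trD charF cardF); congr tr; ring.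
have := congr1 sg L0; rewrite !(exppD charF) sti (expp0 charF) => <-.
by rewrite [sg (_ * _ * _)]exppM [sg (c * _)]exppM; ring.
Qed.

(** Reduction of order: with z = t z1 for a nonzero solution z1, the difference sg t - t solves a
    first-order equation, so it takes at most p values, and each determines t up to an element fixed
    by [sg]. *)
Lemma card_radical_le_p2 u c : c != 0 -> (#|radical (Bf u c)| <= p ^ 2)%N.
Proof.
move=> c0; have p_gt0 := prime_gt0 p_pr.
have [z1 /andP[z10 /eqP z1E]|nz] := pickP [pred z | (z != 0) &&
   (sg c * sg (sg z) + sg (2%:R * u) * sg z + c * z == 0)]; last first.
  apply: leq_trans (_ : 1 <= _)%N; last by rewrite expn_gt0 p_gt0.
  rewrite -(cards1 (0 : F)); apply/subset_leq_card/subsetP=> z /radical_semilinear zE.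
  by have := nz z; rewrite /= zE eqxx andbT inE => /negbFE.
pose a := sg c * sg (sg z1); pose b := c * z1.
have a0 : a != 0 by rewrite mulf_neq0 // ?(expp_eq0 charF).
pose f z := sg (z / z1) - z / z1.
rewrite expnS expn1.
apply: leq_trans (@card_fibres_leq _ _ f _ [set s | a * sg s == b * s]%R p _ _) _.
- move=> z /radical_semilinear; move: z1E; rewrite inE /f /a /b; set d := sg (2%:R * u) => z1E.
  move: (z / z1) (divfK z10 z) => t <-.
  rewrite !exppM (exppD charF) (exppN charF) -subr_eq0 => zE.
  apply/eqP; transitivity (0 - sg t * 0); last by rewrite mulr0 subrr.
  rewrite -[X in _ = X - _]zE -[X in _ = _ - _ * X]z1E; ring.
- move=> z0 _; apply: leq_trans card_fixed_leq.
  rewrite -[X in (X <= _)%N](card_imset _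
    (inj_comp (addrI (- (z0 / z1))) (mulIf (invr_neq0 z10)))) /=.
  apply/subset_leq_card/subsetP=> _ /imsetP[z zE ->] /=.
  move: zE; rewrite !inE => /andP[_]; rewrite /f (exppD charF) (exppN charF) => /eqP fz.
  by rewrite -[sg (z / z1)](subrK (z / z1)) fz; apply/eqP; ring.
by rewrite leq_mul2r card_semilinear_leq ?orbT.
Qed.

Lemma card_radical_le1 u : u != 0 -> (#|radical (Bf u 0%R)| <= 1)%N.
Proof.
move=> u0; rewrite -(cards1 (0 : F)); apply/subset_leq_card/subsetP=> x /radical_semilinear.
rewrite (expp0 charF) !mul0r addr0 add0r inE => /eqP.
rewrite mulf_eq0 !(expp_eq0 charF) mulf_eq0 (negPf u0) orbF.
case/orP=> // two0; have := two_neq0_Fp p_pr p_odd.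
by rewrite -(fpin_eq0 charF) (fpin_nat charF) two0.
Qed.

Variable lam : 'F_p.
Hypotheses (lam_nsq : forall x, x ^+ 2 != lam) (m_odd : odd m).

Definition Tf (u c : F) : algC := \sum_(y : 'F_p | y != 0) qsum (Qf u c) setT y.

Lemma Tf_00 : Tf 0 0 = (p%:R - 1) * p%:R ^+ m.
Proof.
have q0 y : qsum (Qf 0 0) setT y = p%:R ^+ m.
  rewrite -natrX -cardF -cardsT -(qsum0 (Qf 0 0)); apply: eq_bigr => x _.
  by rewrite /Qf !mul0r addr0 (tr0 charF cardF) mulr0.
by rewrite /Tf (eq_bigr _ (fun y _ => q0 y)) sum_Fp_neq0_const.
Qed.

Lemma Tf_u0 u : u != 0 -> Tf u 0 = 0.
Proof.
move=> u0; have [r [rm radE]] := qsum_total charF p_odd lam_nsq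
  (QfD u 0) (QfZ u 0) (BfD u 0) (BfZ u 0) cardF.
have := card_radical_le1 u0; rewrite radE -[X in (_ <= X)%N](expn0 p) leq_exp2l ?prime_gt1 //.
by rewrite leqn0 subn_eq0 => mr; rewrite (_ : r = m) ?m_odd //; lia.
Qed.

(** For even r, the oddness of m and m - r <= 2 force r = m - 1, whence w^2 = p^(m+1). *)
Lemma Tf_values u c (v := (p%:R - 1) * p%:R ^+ (m.+1)./2) :
  c != 0 -> [\/ Tf u c = 0, Tf u c = v | Tf u c = - v].
Proof.
move=> c0; have [r [rm radE]] := qsum_total charF p_odd lam_nsq
  (QfD u c) (QfZ u c) (BfD u c) (BfZ u c) cardF.
have := card_radical_le_p2 u c0; rewrite radE leq_exp2l ?prime_gt1 // => mr2.
case: ifP => r_odd; first by constructor 1.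
case=> w w2 Tw.
have e : (m + (m - r) = (m.+1)./2 * 2)%N by lia.
move/eqP: w2; rewrite e natrX exprM eqf_sqr /v /Tf Tw.
case/orP=> /eqP->; first by constructor 2.
by constructor 3; rewrite mulrN.
Qed.

(* Summing over u keeps only the terms with al i = 0, in which c is harmless. *)
Lemma sum_u_indep_c (I : finType) (P : pred I) (al be : I -> F) c :
    (forall i, P i -> al i = 0 -> be i = 0) ->
  \sum_u \sum_(i | P i) chr (tr p m (u * al i + c * be i)) =
  \sum_u \sum_(i | P i) chr (tr p m (u * al i + 0 * be i)).
Proof.
move=> al_be; rewrite exchange_big [RHS]exchange_big; apply: eq_bigr => i Pi /=.
have split_c d : \sum_u chr (tr p m (u * al i + d * be i)) =
    (\sum_u chr (tr p m (u * al i))) * chr (tr p m (d * be i)).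
  by rewrite mulr_suml; apply: eq_bigr => u _; rewrite (trD charF cardF) chrD.
rewrite !split_c (sum_chr_tr charF cardF).
by case: eqP => [/(al_be _ Pi)->|_]; rewrite ?mulr0 ?mul0r.
Qed.

(** For t = (y, x) these are the coefficients of u and c in y(u x^2 + c x^(p^k+1)), which puts T in
    the shape of [sum_u_indep_c]. *)
Let al (t : 'F_p * F) := fpin F t.1 * t.2 ^+ 2.
Let be (t : 'F_p * F) := fpin F t.1 * t.2 ^+ (p ^ k + 1).

Let TfE u c : Tf u c =
  \sum_(t : 'F_p * F | t.1 != 0) chr (tr p m (u * al t + c * be t)).
Proof.
rewrite /Tf /qsum pair_big /=; apply: eq_big => [t|t _]; first by rewrite inE andbT.
by rewrite /Qf -(tr_fpinM charF cardF) /al /be; congr (chr (tr _ _ _)); ring.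
Qed.

Let al_be (t : 'F_p * F) : t.1 != 0 -> al t = 0 -> be t = 0.
Proof.
move=> t0 /eqP; rewrite /al /be mulf_eq0 (fpin_eq0 charF) (negPf t0) sqrf_eq0 => /eqP->.
by rewrite expr_pk1 !mulr0.
Qed.

(** Frobenius maps s to s or -s. In the second case its m-th power, with m odd, gives s = -s, so s =
    0. *)
Lemma sqrt_in_Fp (s : F) (a : 'F_p) : s ^+ 2 = fpin F a -> expp p 1 s = s.
Proof.
move=> sa; have : expp p 1 s ^+ 2 == s ^+ 2 by rewrite expr2 -exppM -expr2 sa (expp_fpin charF).
rewrite eqf_sqr => /orP[]/eqP // sN.
have sn n : expp p n s = (-1) ^+ n * s.
  elim: n => [|n IH]; first by rewrite /expp expr1 mul1r.
  rewrite -addn1 -expp_add sN (exppN charF) IH exprD expr1; ring.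
have /eqP := expp_card cardF s; rewrite sn -signr_odd m_odd expr1 mulN1r.
rewrite -subr_eq0 -opprD oppr_eq0 -mulr2n -mulr_natl mulf_eq0.
case/orP=> [two0|/eqP->]; last exact: (expp0 charF).
by have := two_neq0_Fp p_pr p_odd; rewrite -(fpin_eq0 charF) (fpin_nat charF) two0.
Qed.

(** If y x^2 + y' x'^2 = 0 with x' nonzero, the square of s = x/x' lies in F_p, hence s does too and
    [sg] fixes it. The second sum is then (y s^2 + y') x'^(p^k+1) = 0. *)
Let al_be2 (t t' : 'F_p * F) : t.1 != 0 -> t'.1 != 0 -> al t + al t' = 0 -> be t + be t' = 0.
Proof.
case: t t' => [y x] [y' x']; rewrite /al /be /= => y0 y'0.
have [->|x'0] := eqVneq x' 0.
  rewrite expr0n mulr0 addr0 => /(@al_be (y, x) y0); rewrite /be /= => ->.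
  by rewrite expr_pk1 !mulr0 addr0.
move: (x / x') (divfK x'0 x) => s <-.
rewrite !exprMn mulrA -mulrDl => /eqP; rewrite mulf_eq0 sqrf_eq0 (negPf x'0) orbF.
move/eqP=> s0; have fy0 : fpin F y != 0 by rewrite (fpin_eq0 charF).
have sE : s ^+ 2 = fpin F (- y' / y).
  apply: (mulfI fy0); rewrite -(fpinM charF) [y * _]mulrC divfK //.
  by apply/eqP; rewrite (fpinN charF) -addr_eq0 s0.
have sk : sg s = s by rewrite -(muln1 k) expp_iter // (sqrt_in_Fp sE).
by rewrite [s ^+ _]expr_pk1 sk -expr2 mulrA -mulrDl s0 mul0r.
Qed.

(** The moment may be computed at c = 0, where only u = 0 contributes. *)
Lemma Tf_moment1 c : \sum_u Tf u c = (p%:R - 1) * p%:R ^+ m.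
Proof.
under eq_bigr => u _ do rewrite TfE.
rewrite sum_u_indep_c; last exact: al_be.
under eq_bigr => u _ do rewrite -TfE.
by rewrite (bigD1 0) //= Tf_00 big1 ?addr0 // => u; exact: Tf_u0.
Qed.

Lemma Tf_moment2 c : \sum_u Tf u c ^+ 2 = ((p%:R - 1) * p%:R ^+ m) ^+ 2.
Proof.
(* The square is a sum over two pairs (y, x), again of the shape required by [sum_u_indep_c], now
   with [al_be2]. *)
have sqE d u : Tf u d ^+ 2 = \sum_(t : ('F_p * F) * ('F_p * F) | (t.1.1 != 0) && (t.2.1 != 0))
    chr (tr p m (u * (al t.1 + al t.2) + d * (be t.1 + be t.2))).
  rewrite expr2 TfE big_distrlr pair_big /=; apply: eq_bigr => t _.
  by rewrite -chrD // -(trD charF cardF); congr (chr (tr _ _ _)); ring.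
under eq_bigr => u _ do rewrite sqE.
rewrite sum_u_indep_c => [|t /andP[t1 t2]]; last exact: al_be2.
under eq_bigr => u _ do rewrite -sqE.
by rewrite (bigD1 0) //= Tf_00 big1 ?addr0 // => u u0; rewrite Tf_u0 // expr0n.
Qed.

End TraceForm.


(** * Counting pairs with a prescribed sum of values *)

Section PairCount.

Variables (T : finType) (f : T -> int).
Hypothesis f_sign : forall u, [\/ f u = 0, f u = 1 | f u = -1].

Definition npairs (w : int) : algC := \sum_u \sum_v (f u + f v == w)%:R.

(** The witnesses count the arguments at which f is 0, 1 and -1; they serve all g at once, in
    particular constants, moments and indicators. *)
Lemma sum_sign : exists n0 n1 n2 : algC, forall g : int -> algC,
  \sum_u g (f u) = g 0 * n0 + g 1 * n1 + g (-1) * n2.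
Proof.
exists (\sum_u (f u == 0)%:R), (\sum_u (f u == 1)%:R), (\sum_u (f u == -1)%:R) => g.
rewrite !mulr_sumr -!big_split /=; apply: eq_bigr => u _.
by case: (f_sign u) => ->; rewrite !(mulr1, mulr0, addr0, add0r).
Qed.

(** The size of T and the two moments give a0 + a1 + a2 = d, a1 - a2 = r and a1 + a2 = r^2, which
    determine the three multiplicities. *)
Lemma npairs_sign (r d : algC) (w : int)
    (n0 := d - r ^+ 2) (n1 := 2%:R^-1 * (r ^+ 2 + r)) (n2 := 2%:R^-1 * (r ^+ 2 - r)) :
    #|T|%:R = d -> \sum_u (f u)%:~R = r -> \sum_u (f u)%:~R ^+ 2 = r ^+ 2 ->
  npairs w = (0 == w)%:R * (n0 ^+ 2 + 2%:R * n1 * n2) + (1 == w)%:R * (2%:R * n0 * n1)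
    + (-1 == w)%:R * (2%:R * n0 * n2) + (2 == w)%:R * n1 ^+ 2 + (- 2 == w)%:R * n2 ^+ 2.
Proof.
have [a0 [a1 [a2 H]]] := sum_sign.
move=> cT s1 s2.
have e0 : d = a0 + a1 + a2.
  by have := H (fun=> 1); rewrite !mul1r sumr_const cT.
have e1 : r = a1 - a2.
  have := H (fun z => z%:~R); rewrite s1 => ->.
  by rewrite mulr0z mulr1z mulrN1z; ring.
have e2 : r ^+ 2 = a1 + a2.
  have := H (fun z => z%:~R ^+ 2); rewrite s2 => ->.
  by rewrite mulr0z mulr1z mulrN1z; ring.
have two0 : (2%:R : algC) != 0 by rewrite pnatr_eq0.
have n0E : n0 = a0 by rewrite /n0 e0 e2; ring.
have n1E : n1 = a1.
  by apply: (mulfI two0); rewrite /n1 mulVKf // e2 e1; ring.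
have n2E : n2 = a2.
  by apply: (mulfI two0); rewrite /n2 mulVKf // e2 e1; ring.
rewrite /npairs (H (fun a => \sum_v (a + f v == w)%:R)).
rewrite !(H (fun b => (_ + b == w)%:R)) n0E n1E n2E.
rewrite -!/(0 : int) !addr0 !add0r subrr addNr.
rewrite (_ : 1 + 1 = 2 :> int) // (_ : -1 - 1 = -2 :> int) //.
ring.
Qed.

End PairCount.

(** The case c = 0, where T is concentrated at u = 0: both, exactly one, or neither of the two
    arguments equals z. *)
Lemma npairs_delta (T : finType) (z : T) (R : nat) (w : int) (d : algC) :
  #|T|%:R = d ->
  npairs (fun u => if u == z then R%:Z else 0) w =
  (R%:Z + R%:Z == w)%:R + (R%:Z == w)%:R * (2%:R * (d - 1)) + (0 == w)%:R * (d - 1) ^+ 2.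
Proof.
move=> cT; have sumE (g : int -> algC) :
    \sum_u g (if u == z then R%:Z else 0) = g R%:Z + g 0 * (d - 1).
  rewrite (bigD1 z) //= eqxx; congr (_ + _).
  rewrite (eq_bigr (fun=> g 0)) => [|u /negPf->] //.
  rewrite sumr_const -mulr_natr; congr (_ * _).
  have -> : #|[pred u | u != z]| = #|T|.-1 by rewrite (cardC1 z).
  have : (0 < #|T|)%N by apply/card_gt0P; exists z.
  by case: #|T| cT => // n <- _; rewrite -natr1 addrK.
rewrite /npairs (sumE (fun a => \sum_v (a + _ == w)%:R)).
rewrite !(sumE (fun b => (_ + b == w)%:R)) addr0 !add0r.
ring.
Qed.

(** As 2 is invertible, (a, b) can be replaced by (a + b, a - b), after which the two summands vary
    independently. *)
Lemma card_pairs_fibre (F : finFieldType) (tau : F -> F -> int) (w : int) :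
  2%:R != 0 :> F ->
  #|[set t : F * F * F |
      tau (t.1.1 + t.1.2) t.2 + tau (t.1.1 - t.1.2) t.2 == w]|%:R =
  \sum_c npairs (fun u => tau u c) w.
Proof.
move=> two0; pose h (t : F * F * F) := (t.1.1 + t.1.2, t.1.1 - t.1.2, t.2).
have h_inj : injective h.
  move=> [[a b] c] [[a' b'] c'] [] /= ab ab' ->.
  have aa : a = a'.
    apply: (mulfI two0); have -> : 2%:R * a = (a + b) + (a - b) by ring.
    by rewrite ab ab'; ring.
  by move: ab; rewrite aa => /addrI->.
rewrite -sum1_card natr_sum big_mkcond /=.
transitivity (\sum_t (tau t.1.1 t.2 + tau t.1.2 t.2 == w)%:R : algC).
  rewrite [RHS](reindex_inj h_inj); apply: eq_bigr => t _.
  by rewrite inE /=; case: eqP.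
rewrite -(pair_bigA _ (fun (x : F * F) c => (tau x.1 c + tau x.2 c == w)%:R)) /=.
rewrite exchange_big; apply: eq_bigr => c _.
by rewrite -(pair_bigA _ (fun u v => (tau u c + tau v c == w)%:R)).
Qed.

Lemma S_Tf (F : finFieldType) (p m k : nat) (lam : 'F_p) (a b c : F) :
    p \in [pchar F] -> #|F| = (p ^ m)%N -> lam != 0 ->
  S p m k (fpin F lam) a b c = Tf p m k (a + b) c + Tf p m k (a - b) c.
Proof.
move=> charF cardF lam0.
rewrite /S (sum_nonzero_Fp charF (fun y => \sum_x (psi p (y%:R * _) + psi p (y%:R * _)))).
under eq_bigr => y _ do rewrite big_split /=.
rewrite big_split /=; congr (_ + _).
  apply: eq_bigr => y _; apply: eq_big => [x|x _]; first by rewrite inE.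
  by rewrite (psi_tr charF cardF).
rewrite [RHS](reindex_inj (mulfI lam0)) /=.
apply: eq_big => [y|y _]; first by rewrite mulf_eq0 (negPf lam0).
apply: eq_big => [x|x _]; first by rewrite inE.
rewrite (psi_tr charF cardF) [lam * y]mulrC -[y * lam * _]mulrA /Qf.
rewrite -[lam * _](tr_fpinM charF cardF).
by congr (chr (_ * tr _ _ _)); ring.
Qed.

(** * Evaluation of the frequencies at the seven values *)

Section FrequencyFormula.

Variables (R : nat) (P r : algC).
Hypothesis R_gt2 : (2 < R)%N.
Let n0 := P - r ^+ 2.
Let n1 := 2%:R^-1 * (r ^+ 2 + r).
Let n2 := 2%:R^-1 * (r ^+ 2 - r).

(** The first line is the contribution of c = 0 and the rest that of the P - 1 nonzero c. Here w
    stands for S divided by v1, and R for T(0,0) divided by v1. *)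
Definition freq_formula (w : int) : algC :=
  (R%:Z + R%:Z == w)%:R + (R%:Z == w)%:R * (2%:R * (P - 1)) + (0 == w)%:R * (P - 1) ^+ 2
  + (P - 1) * ((0 == w)%:R * (n0 ^+ 2 + 2%:R * n1 * n2) + (1 == w)%:R * (2%:R * n0 * n1)
  + (-1 == w)%:R * (2%:R * n0 * n2) + (2 == w)%:R * n1 ^+ 2 + (- 2 == w)%:R * n2 ^+ 2).

Let neqF (a b : int) : a <> b -> (a == b) = false. Proof. by move/eqP/negPf. Qed.

Let simp01 := (mul0r, mul1r, mulr0, add0r, addr0).

Lemma freq_formula_2R : freq_formula (R%:Z + R%:Z) = 1.
Proof. by rewrite /freq_formula eqxx !neqF ?simp01 //; lia. Qed.

Lemma freq_formula_R : freq_formula R%:Z = 2%:R * (P - 1).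
Proof.
rewrite /freq_formula eqxx (_ : (R%:Z + R%:Z == R%:Z) = false); last by lia.
by rewrite !neqF ?simp01 //; lia.
Qed.
(** Since R > 2, the values R and 2R cannot coincide with a sum of two signs. *)
Lemma freq_formula_small (w : int) : (-2 <= w <= 2) -> freq_formula w = (0 == w)%:R * (P - 1) ^+ 2
  + (P - 1) * ((0 == w)%:R * (n0 ^+ 2 + 2%:R * n1 * n2) + (1 == w)%:R * (2%:R * n0 * n1)
  + (-1 == w)%:R * (2%:R * n0 * n2) + (2 == w)%:R * n1 ^+ 2 + (- 2 == w)%:R * n2 ^+ 2).
Proof.
move=> w2; rewrite /freq_formula (_ : (R%:Z + R%:Z == w) = false); last by lia.
by rewrite (_ : (R%:Z == w) = false) ?simp01 //; lia.
Qed.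

Lemma freq_formula_1 : freq_formula 1 = (P - 1) * (P - r ^+ 2) * (r ^+ 2 + r).
Proof. by rewrite freq_formula_small // /= ?simp01 /n0 /n1; field. Qed.

Lemma freq_formulaN1 : freq_formula (-1) = (P - 1) * (P - r ^+ 2) * (r ^+ 2 - r).
Proof. by rewrite freq_formula_small // /= ?simp01 /n0 /n2; field. Qed.

Lemma freq_formula_2 : freq_formula 2 = 4%:R^-1 * (P - 1) * (r ^+ 2 + r) ^+ 2.
Proof. by rewrite freq_formula_small // /= ?simp01 /n1; field. Qed.

Lemma freq_formulaN2 : freq_formula (- 2) = 4%:R^-1 * (P - 1) * (r ^+ 2 - r) ^+ 2.
Proof. by rewrite freq_formula_small // /= ?simp01 /n2; field. Qed.

Lemma freq_formula_0 (q : algC) : P = q * r ^+ 2 -> freq_formula 0 =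
  (P - 1) * (P ^+ 2 + 3%:R / 2%:R * r ^+ 4 - 2%:R * (q * r ^+ 4)
    + P - 2%:R^-1 * r ^+ 2 - 1).
Proof. by rewrite freq_formula_small // /= ?simp01 /n0 /n1 /n2 => ->; field. Qed.

End FrequencyFormula.

(** * Assembly of the value distribution *)

Theorem theorem3p5 (F : finFieldType) (p m k l : nat)
  (hp : prime p) (hpodd : odd p) (hchar : p \in [pchar F])
  (hcard : #|F| = (p ^ m)%N)
  (hm3 : (3 <= m)%N) (hmodd : odd m)
  (hk1 : (1 <= k)%N) (hkeven : ~~ odd k) (hmk : coprime m k)
  (hlam : forall n : nat, (n%:R : F) ^+ 2 != l%:R) :
  let lam : F := l%:R in
  let q : algC := p%:R in
  let P := q ^+ m in
  let A := q ^+ m.-1 + q ^+ (m.-1)./2 in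
  let B := q ^+ m.-1 - q ^+ (m.-1)./2 in
  let v1 := (q - 1) * q ^+ (m.+1)./2 in
  (forall a b c : F, S p m k lam a b c \in
     [:: 2%:R * (q - 1) * P; (q - 1) * P; v1; - v1; 2%:R * v1; - (2%:R * v1); 0]) /\
  (freq p m k lam (2%:R * (q - 1) * P))%:R = 1 :> algC /\
  (freq p m k lam ((q - 1) * P))%:R = 2%:R * (P - 1) :> algC /\
  (freq p m k lam v1)%:R = (P - 1) * (P - q ^+ m.-1) * A :> algC /\
  (freq p m k lam (- v1))%:R = (P - 1) * (P - q ^+ m.-1) * B :> algC /\
  (freq p m k lam (2%:R * v1))%:R = 4%:R^-1 * (P - 1) * A ^+ 2 :> algC /\
  (freq p m k lam (- (2%:R * v1)))%:R = 4%:R^-1 * (P - 1) * B ^+ 2 :> algC /\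
  (freq p m k lam 0)%:R =
     (P - 1) * (q ^+ (2 * m) + 3%:R / 2%:R * q ^+ (2 * m.-1) - 2%:R * q ^+ (2 * m).-1
                + P - 2%:R^-1 * q ^+ m.-1 - 1) :> algC.
Proof.
move=> lam q P A B v1.
pose lam' : 'F_p := l%:R.
have lamE : lam = fpin F lam' by rewrite (fpin_nat hchar).
have lam_nsq (x : 'F_p) : x ^+ 2 != lam'.
  apply: contraNneq (hlam x) => xl.
  by rewrite -[l%:R]/lam lamE -xl -[x%:R]/(fpin F x) !expr2 (fpinM hchar).
have lam0 := nsq_neq0 lam_nsq.
have two0 : (2%:R : F) != 0.
  by rewrite -(fpin_nat hchar) (fpin_eq0 hchar) two_neq0_Fp.
(* With m = 2n + 1 one has p^(m-1) = r^2 and T(0,0) = v1 r for r = p^n. *)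
pose n := m./2; have mE : m = n.*2.+1 by rewrite /n; lia.
pose R := (p ^ n)%N; pose r : algC := q ^+ n.
have RE : r = R%:R by rewrite natrX.
have p3 : (2 < p)%N by have := prime_gt1 hp; lia.
have R3 : (2 < R)%N.
  by apply: leq_trans p3 _; rewrite -{1}(expn1 p) leq_exp2l ?prime_gt1 // /n; lia.
have PE : P = q * r ^+ 2 by rewrite /P mE exprS -exprM muln2.
have v1E : v1 = (q - 1) * (q * r).
  by rewrite /v1 -exprS; congr (_ * _ ^+ _); rewrite mE; lia.
have q1E : q ^+ m.-1 = r ^+ 2 by rewrite mE -exprM muln2.
have rE : q ^+ (m.-1)./2 = r by congr (_ ^+ _); rewrite /n; lia.
have v0 : v1 != 0.
  rewrite v1E RE -(natrB _ (prime_gt0 hp)) -!natrM pnatr_eq0 !muln_eq0 !negb_or.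
  by apply/and3P; split; lia.
have TRv : v1 * r = (q - 1) * P by rewrite v1E PE; ring.
(* T(u,c) divided by v1, as an integer: R or 0 for c = 0, a sign or 0 for the other c. *)
pose tau (u c : F) : int := if c == 0 then (if u == 0 then R%:Z else 0) else
   if Tf p m k u c == 0 then 0 else if Tf p m k u c == v1 then 1 else -1.
have tauE u c : Tf p m k u c = v1 * (tau u c)%:~R.
  rewrite /tau; have [->|c0] := eqVneq c 0.
    have [->|u0] := eqVneq u 0; first by rewrite (Tf_00 k hchar hcard) -TRv RE.
    by rewrite (Tf_u0 hchar hpodd hcard hmk lam_nsq) // mulr0.
  case: eqP => [->|n0]; first by rewrite mulr0.
  case: eqP => [->|n1]; first by rewrite mulr1.
  have [//|//|->] := Tf_values hchar hpodd hcard hmk lam_nsq hmodd u c0.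
  by rewrite mulrN1.
have SE a b c : S p m k lam a b c = v1 * (tau (a + b) c + tau (a - b) c)%:~R.
  by rewrite lamE (S_Tf _ _ _ _ hchar hcard lam0) !tauE rmorphD mulrDr.
have tau_sign u c : c != 0 -> [\/ tau u c = 0, tau u c = 1 | tau u c = -1].
  move=> c0; rewrite /tau (negPf c0); do 2 (case: ifP => _; first by [constructor 1|constructor 2]).
  by constructor 3.
have cardq : #|F|%:R = P :> algC by rewrite hcard natrX.
have tau_sum c : c != 0 -> \sum_u (tau u c)%:~R = r.
  move=> c0; apply: (mulfI v0); rewrite mulr_sumr TRv.
  by rewrite -(Tf_moment1 hchar hpodd hcard hmk lam_nsq hmodd c); apply: eq_bigr => u _.
have tau_sum2 c : c != 0 -> \sum_u (tau u c)%:~R ^+ 2 = r ^+ 2.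
  move=> c0; apply: (mulfI (expf_neq0 2 v0)); rewrite mulr_sumr -exprMn TRv.
  rewrite -(Tf_moment2 hchar hpodd hcard hmk lam_nsq hmodd c); apply: eq_bigr => u _.
  by rewrite -exprMn -tauE.
(* Division by the nonzero v1 turns the condition S = v into an integer equation for [tau]; the
   fibre c = 0 is then counted apart from the others. *)
have freqE (w : int) v : v = v1 * w%:~R -> (freq p m k lam v)%:R = freq_formula R P r w.
  move=> vw; have -> : freq p m k lam v = #|[set t : F * F * F |
      tau (t.1.1 + t.1.2) t.2 + tau (t.1.1 - t.1.2) t.2 == w]|.
    by rewrite /freq; apply: eq_card => t; rewrite !inE SE vw (inj_eq (mulfI v0)) eqr_int.
  rewrite card_pairs_fibre // (bigD1 0) //=; congr (_ + _).
    by rewrite -(npairs_delta 0 R w cardq) /npairs /tau eqxx.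
  rewrite (eq_bigr _ (fun c c0 => npairs_sign (fun u => tau_sign u c c0) w cardq
    (tau_sum c c0) (tau_sum2 c c0))) sumr_const -[LHS]mulr_natl; congr (_ * _).
  have -> : #|[pred c : F | c != 0]| = #|F|.-1 by rewrite (cardC1 (0 : F)).
  have : (0 < #|F|)%N by apply/card_gt0P; exists 0.
  by case: #|F| cardq => // N <- _; rewrite -natr1 addrK.
have Rz : (R%:Z)%:~R = r by rewrite RE.
split.
  move=> a b c; rewrite SE; have [->|c0] := eqVneq c 0.
    rewrite /tau eqxx; do 2 case: ifP => _.
    - rewrite rmorphD /= Rz mulrDr TRv !inE; apply/orP; left; apply/eqP; ring.
    - by rewrite addr0 Rz TRv !inE eqxx orbT.
    - by rewrite add0r Rz TRv !inE eqxx orbT.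
    by rewrite addr0 mulr0 !inE eqxx !orbT.
  (* Of the nine combinations only 1 + 1 and -1 - 1 are not settled by simplification. *)
  have [-> | -> | ->] := tau_sign (a + b) c c0;
  have [-> | -> | ->] := tau_sign (a - b) c c0;
  rewrite ?(addr0, add0r, subrr, addNr, mulr0, mulr1, mulrN1) !inE ?eqxx ?orbT //.
  - have -> : v1 * (1 + 1)%:~R = 2%:R * v1 by rewrite mulrC.
    by rewrite eqxx ?orbT.
  - have -> : v1 * (-1 - 1)%:~R = - (2%:R * v1) by rewrite -opprD rmorphN mulrN mulrC.
    by rewrite eqxx ?orbT.
split.
  rewrite (freqE (R%:Z + R%:Z)) ?freq_formula_2R //.
  by rewrite rmorphD /= Rz [v1 * _]mulrDr TRv; ring.
split; first by rewrite (freqE R%:Z) ?freq_formula_R // Rz TRv.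
split; first by rewrite (freqE 1) ?mulr1 // freq_formula_1 // /A q1E rE.
split; first by rewrite (freqE (-1)) ?mulrN1 // freq_formulaN1 // /B q1E rE.
split.
  rewrite (freqE 2); last by rewrite mulrC.
  by rewrite freq_formula_2 // /A q1E rE.
split.
  rewrite (freqE (- 2)); last by rewrite rmorphN mulrN [v1 * _]mulrC.
  by rewrite freq_formulaN2 // /B q1E rE.
rewrite (freqE 0) ?mulr0 // (freq_formula_0 R3 PE) q1E.
have -> : q ^+ (2 * m) = P ^+ 2 by rewrite mulnC exprM.
have -> : q ^+ (2 * m.-1) = r ^+ 4 by rewrite mulnC exprM q1E -exprM.
(* The exponent 2m - 1 equals 4n + 1. *)
have -> // : q ^+ (2 * m).-1 = q * r ^+ 4.
by rewrite -exprM -exprS; congr (_ ^+ _); rewrite mE; lia.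
Qed.
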